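(* Let $r:[0,\infty)\to[0,\infty)$ be any $C^2$ function satisfying $r''>0$ on $(0,\infty)$, $r(0)=0$, $r'(0)=1$ and $r'(\infty)=\infty$ (i.e. $\lim_{x\to\infty}r'(x)=\infty$). There exists a function $J:[0,\infty)\to[0,\infty)$ such that: - $J(0)>0$, $J\in C^1$ is increasing and convex on $[0,\infty)$ and eventually $C^2$ (i.e. $C^2$ on some interval $(a,\infty)$); - $(\log J)'$ is regularly varying of index $\rho-1$ for some $\rho\in(0,\infty]$ (where $\rho=\infty$ means rapidly varying of index $\infty$) and $\displaystyle\lim_{u\to\infty}\frac{(J'(u))^2}{J''(u)J(u)}=1$; - $J(x)\ge\exp(r(x))$ for all $x\ge0$.
   Context: ''Increasing'' means nondecreasing. A continuous $g:(a,\infty)\to(0,\infty)$ is regularly varying of index $\rho\in\mathbb{R}$ if $\lim_{x\to\infty}g(\lambda x)/g(x)=\lambda^\rho$ for all $\lambda>0$, and rapidly varying of index $\infty$ if this limit is $0$ for $0<\lambda<1$ and $\infty$ for $\lambda>1$. *)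

(* Defs.v *)
From Stdlib Require Import Reals.
From Coquelicot Require Import Coquelicot.
Open Scope R_scope.

(* A function on [D] is represented by a total function [R -> R] whose values
   outside [D] are irrelevant. *)
Definition nonneg_half_line (x : R) : Prop := 0 <= x.

(* [is_derive] with the increments restricted to [D]: one-sided at an endpoint
   of an interval, the usual derivative at an interior point. *)
Definition is_derive_within (D : R -> Prop) (f : R -> R) (x l : R) : Prop :=
  filterdiff f (within D (locally x)) (fun y => scal y l).

Fixpoint is_Cn_on (n : nat) (D : R -> Prop) (f : R -> R) : Prop :=
  match n with
  | O => continuous_on D f
  | S m => exists f' : R -> R,
      (forall x, D x -> is_derive_within D f x (f' x)) /\ is_Cn_on m D f'
  end.

(* "Increasing" means nondecreasing. *)
Definition increasing_on (D : R -> Prop) (f : R -> R) : Prop :=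
  forall x y, D x -> D y -> x <= y -> f x <= f y.

Definition convex_on (D : R -> Prop) (f : R -> R) : Prop :=
  forall x y t, D x -> D y -> 0 <= t <= 1 ->
    f (t * x + (1 - t) * y) <= t * f x + (1 - t) * f y.

Definition eventually_continuous_positive (g : R -> R) : Prop :=
  exists a : R, continuous_on (fun x => a < x) g /\ forall x, a < x -> 0 < g x.

Definition regularly_varying (g : R -> R) (rho : R) : Prop :=
  eventually_continuous_positive g /\
  forall lambda, 0 < lambda ->
    is_lim (fun x => g (lambda * x) / g x) p_infty (Rpower lambda rho).

Definition rapidly_varying (g : R -> R) : Prop :=
  eventually_continuous_positive g /\
  (forall lambda, 0 < lambda < 1 ->
    is_lim (fun x => g (lambda * x) / g x) p_infty 0) /\
  (forall lambda, 1 < lambda ->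
    is_lim (fun x => g (lambda * x) / g x) p_infty p_infty).

(* Rapid variation of index [-oo] is not considered. *)
Definition varying_of_index (g : R -> R) (rho : Rbar) : Prop :=
  match rho with
  | Finite rho => regularly_varying g rho
  | p_infty => rapidly_varying g
  | m_infty => False
  end.

(* Main.v *)
Require Import Defs.
From Stdlib Require Import Reals Lra FunctionalExtensionality.
From Coquelicot Require Import Coquelicot.
Open Scope R_scope.

(** The index can always be taken to be [rho = +oo], since [J] may grow as fast
    as one likes provided that it grows regularly enough.  Look for
    [J = exp (int_0^x h)], so that [(log J)' = h], and put [w = 1 / h].  Then
    [J'' = (h' + h ^ 2) J] and [J' ^ 2 / (J'' J) = 1 / (1 + h' / h ^ 2)] with
    [h' / h ^ 2 = - w'], so it is enough that [w] be positive, nonincreasing and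
    [C^1], with [w' -> 0], [w (lambda x) / w x -> 0] for [lambda > 1], and
    [1 / w >= r'].

    However fast [r'] grows, a moving average of a small function has all these
    properties.  Let [phi t = exp (- (t + p t))], where [p] is a continuous
    nondecreasing extension of [r'], and [w x = int_x^(x+1) phi].  Since [phi]
    is decreasing, [phi (x+1) <= w x <= phi x], and the upper bound gives
    [1 / w x >= exp (x + p x) >= p x] for [x >= 0].  Since
    [w' x = phi (x+1) - phi x], [w'] tends to [0] merely because [phi] does.  The
    factor [exp (- t)] in [phi] yields [w y <= exp (- (y - x - 1)) w x] as soon
    as [x + 1 <= y], which is rapid variation.  Finally [h] is positive and
    nondecreasing, hence so is [J' = h J], and [J] is convex; and
    [log J - r] vanishes at [0] and has derivative [h - r' >= 0]. *)

Lemma exp_le (x y : R) : x <= y -> exp x <= exp y.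
Proof.
  intros [H | ->]; [now apply Rlt_le, exp_increasing | apply Rle_refl].
Qed.

(** * Derivatives within a set *)

Lemma continuous_of_is_derive (f : R -> R) (x l : R) :
  is_derive f x l -> continuous f x.
Proof.
  intros H. apply (ex_derive_continuous (V := R_NormedModule)). now exists l.
Qed.

Lemma within_filter_lim (D : R -> Prop) (x : R) :
  is_filter_lim (within D (locally x)) x.
Proof.
  intros P HP. unfold within. revert HP; apply filter_imp; auto.
Qed.

(** [filterdiff] asks for the domination estimate at every limit of its filter;
    uniqueness of that limit is what makes [filterdiff] along [within D] a
    statement about the single point [x]. *)
Lemma within_filter_lim_unique (D : R -> Prop) (x z : R) :
  D x -> is_filter_lim (within D (locally x)) z -> z = x.
Proof.
  intros Dx Hz.
  symmetry. apply eq_close. intros eps.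
  assert (H : within D (locally x) (ball z eps)) by apply Hz, locally_ball.
  apply ball_sym. exact (locally_singleton _ _ H Dx).
Qed.

Lemma is_derive_within_of_is_derive (D : R -> Prop) (f : R -> R) (x l : R) :
  D x -> is_derive f x l -> is_derive_within D f x l.
Proof.
  intros Dx [Hl Hd]. split; [exact Hl|].
  intros z Hz. apply within_filter_lim_unique in Hz; [subst z|exact Dx].
  intros eps. unfold within.
  generalize (Hd x (fun P H => H) eps); apply filter_imp; auto.
Qed.

Lemma is_derive_of_is_derive_within (D : R -> Prop) (f : R -> R) (x l : R) :
  locally x D -> is_derive_within D f x l -> is_derive f x l.
Proof.
  intros Dx [Hl Hd]. split; [exact Hl|].
  intros z Hz. apply (@is_filter_lim_locally_unique R_AbsRing R_NormedModule) in Hz.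
  subst z.
  intros eps.
  generalize (filter_and _ _ Dx (Hd x (within_filter_lim D x) eps)).
  apply filter_imp. intros y [H1 H2]. exact (H2 H1).
Qed.

Lemma continuous_on_of_derive_within (D : R -> Prop) (f df : R -> R) :
  (forall x, D x -> is_derive_within D f x (df x)) -> continuous_on D f.
Proof.
  intros H x Dx.
  apply (filterdiff_continuous_aux (F := within D (locally x)) f).
  - exists (fun y => scal y (df x)). exact (H x Dx).
  - apply within_filter_lim.
Qed.

Lemma continuous_on_of_continuous (D : R -> Prop) (f : R -> R) :
  (forall x, continuous f x) -> continuous_on D f.
Proof.
  intros H. apply continuous_on_forall. intros x _. apply H.
Qed.

Lemma is_derive_within_minus (D : R -> Prop) (f g : R -> R) (x lf lg : R) :
  is_derive_within D f x lf -> is_derive_within D g x lg ->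
  is_derive_within D (fun y => f y - g y) x (lf - lg).
Proof.
  intros Hf Hg.
  apply (filterdiff_ext_lin _ (fun y : R => minus (scal y lf) (scal y lg))).
  - exact (filterdiff_minus_fct f g _ _ Hf Hg).
  - intros y. unfold minus, plus, opp, scal; simpl; unfold mult; simpl. ring.
Qed.

Lemma is_C1_everywhere (D : R -> Prop) (f df : R -> R) :
  (forall x, is_derive f x (df x)) -> (forall x, continuous df x) ->
  is_Cn_on 1 D f.
Proof.
  intros Hf Hdf. exists df. split.
  - intros x Dx. apply is_derive_within_of_is_derive; auto.
  - now apply continuous_on_of_continuous.
Qed.

(** * Monotonicity, convexity and exponential limits *)

Lemma locally_nonneg_half_line (x : R) : 0 < x -> locally x nonneg_half_line.
Proof.
  intros Hx. apply (filter_imp (fun y => 0 < y)).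
  - intros y Hy. now apply Rlt_le.
  - now apply (open_gt 0).
Qed.

(** Freezing the argument at [0] for negative arguments turns continuity within
    the half-line into continuity on the whole line, the form that the mean
    value theorem and the integral need. *)
Lemma continuous_clamped (f : R -> R) :
  continuous_on nonneg_half_line f ->
  forall x, continuous (fun t => f (Rmax t 0)) x.
Proof.
  intros Hf x.
  apply (filterlim_comp _ _ _ (fun t => Rmax t 0) f _
           (within nonneg_half_line (locally (Rmax x 0)))).
  - intros P HP.
    assert (Hc : continuous (fun t => Rmax t 0) x).
    { apply continuity_pt_filterlim.
      apply (continuity_pt_ext (fun t => (t + 0 + Rabs (t - 0)) / 2)).
      - intros t. unfold Rmax, Rabs.
        destruct (Rle_dec t 0), (Rcase_abs (t - 0)); lra.
      - reg. }
    generalize (Hc _ HP). unfold filtermap. apply filter_imp.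
    intros t Ht. apply Ht. unfold nonneg_half_line. apply Rmax_r.
  - apply Hf. unfold nonneg_half_line. apply Rmax_r.
Qed.

Lemma increasing_on_of_derive_nonneg (f df : R -> R) :
  (forall x, 0 <= x -> is_derive_within nonneg_half_line f x (df x)) ->
  (forall x, 0 < x -> 0 <= df x) ->
  increasing_on nonneg_half_line f.
Proof.
  intros Hf Hdf x y Hx Hy Hxy. unfold nonneg_half_line in Hx, Hy.
  (* [MVT_gen] may return the endpoint [0], about which [df] says nothing: cut
     the derivative off there so that it is nonnegative everywhere. *)
  destruct (MVT_gen (fun t => f (Rmax t 0)) x y (fun t => Rmax 0 (df t)))
    as [c [_ Heq]].
  - rewrite Rmin_left, Rmax_right by lra. intros z Hz.
    rewrite Rmax_right by (apply Hdf; lra).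
    apply (is_derive_ext_loc f).
    + generalize (locally_nonneg_half_line z ltac:(lra)). apply filter_imp.
      intros t Ht. now rewrite Rmax_left.
    + apply (is_derive_of_is_derive_within nonneg_half_line).
      * apply locally_nonneg_half_line. lra.
      * apply Hf. lra.
  - intros z _. apply continuity_pt_filterlim.
    apply continuous_clamped, (continuous_on_of_derive_within _ _ df), Hf.
  - rewrite !Rmax_left in Heq by lra.
    assert (0 <= Rmax 0 (df c) * (y - x)).
    { apply Rmult_le_pos; [apply Rmax_l | lra]. }
    lra.
Qed.

Lemma convex_on_of_derive_nondecreasing (D : R -> Prop) (f df : R -> R) :
  (forall x, is_derive f x (df x)) ->
  (forall x y, x <= y -> df x <= df y) ->
  convex_on D f.
Proof.
  intros Hf Hdf x y t _ _ Ht.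
  (* The graph lies above each tangent line; average this over [x] and [y]
     for the tangent at the intermediate point. *)
  assert (Htan : forall z u, f z + df z * (u - z) <= f u).
  { intros z u.
    destruct (MVT_gen f z u df) as [c [Hc Heq]].
    - intros; apply Hf.
    - intros v _. apply continuity_pt_filterlim.
      now apply (continuous_of_is_derive _ _ _ (Hf _)).
    - destruct (Rle_dec z u) as [Hzu|Hzu].
      + rewrite Rmin_left, Rmax_right in Hc by lra.
        assert (df z <= df c) by (apply Hdf; lra). nra.
      + rewrite Rmin_right, Rmax_left in Hc by lra.
        assert (df c <= df z) by (apply Hdf; lra). nra. }
  set (z := t * x + (1 - t) * y).
  assert (H1 := Htan z x). assert (H2 := Htan z y).
  apply (Rmult_le_compat_l t) in H1; [|lra].
  apply (Rmult_le_compat_l (1 - t)) in H2; [|lra].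
  replace (f z) with (t * (f z + df z * (x - z)) + (1 - t) * (f z + df z * (y - z))).
  - lra.
  - unfold z; ring.
Qed.

Lemma is_lim_exp_affine_p (a b : R) :
  0 < a -> is_lim (fun x => exp (a * x + b)) p_infty p_infty.
Proof.
  intros Ha. apply is_lim_comp_lin; [|lra].
  replace (Rbar_plus (Rbar_mult a p_infty) b) with p_infty.
  - apply is_lim_exp_p.
  - rewrite (is_Rbar_mult_unique _ _ p_infty); [reflexivity|].
    apply is_Rbar_mult_sym, is_Rbar_mult_p_infty_pos, Ha.
Qed.

Lemma is_lim_exp_affine_m (a b : R) :
  a < 0 -> is_lim (fun x => exp (a * x + b)) p_infty 0.
Proof.
  intros Ha. apply is_lim_comp_lin; [|lra].
  replace (Rbar_plus (Rbar_mult a p_infty) b) with m_infty.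
  - apply is_lim_exp_m.
  - rewrite (is_Rbar_mult_unique _ _ m_infty); [reflexivity|].
    apply is_Rbar_mult_sym, is_Rbar_mult_p_infty_neg, Ha.
Qed.

(** * A moving average of a rapidly decreasing function *)

Definition damp (p : R -> R) (t : R) : R := exp (- (t + p t)).

Definition window (p : R -> R) (x : R) : R := RInt (damp p) x (x + 1).

Lemma continuous_damp (p : R -> R) (x : R) :
  continuous p x -> continuous (damp p) x.
Proof.
  intros Hp. unfold damp.
  apply (continuous_comp (fun t => - (t + p t)) exp).
  - apply (continuous_opp (fun t => t + p t)).
    apply (continuous_plus (fun t => t) p); [apply continuous_id | exact Hp].
  - apply (ex_derive_continuous (V := R_NormedModule)). auto_derive; auto.
Qed.

Lemma damp_decreasing (p : R -> R) :
  (forall x y, x <= y -> p x <= p y) ->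
  forall x y, x <= y -> damp p y <= exp (- (y - x)) * damp p x.
Proof.
  intros Hp x y Hxy. unfold damp. rewrite <- exp_plus.
  apply exp_le. specialize (Hp x y Hxy). lra.
Qed.

Lemma damp_pos (p : R -> R) (x : R) : 0 < damp p x.
Proof. apply exp_pos. Qed.

Lemma is_lim_damp (p : R -> R) :
  (forall x y, x <= y -> p x <= p y) -> is_lim (damp p) p_infty 0.
Proof.
  intros Hp.
  apply (is_lim_le_le_loc (fun _ => 0) (fun x => exp (-1 * x + - p 0))).
  - exists 0. intros x Hx. split; [apply Rlt_le, damp_pos|].
    apply exp_le. specialize (Hp 0 x ltac:(lra)). lra.
  - apply is_lim_const.
  - apply is_lim_exp_affine_m. lra.
Qed.

(** Averaging over a unit window turns a merely continuous function into a [C^1]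
    one whose derivative is an increment of the function itself, so it
    tends to [0] as soon as the function does. *)
Lemma is_derive_window (p : R -> R) :
  (forall x, continuous p x) ->
  forall x, is_derive (window p) x (damp p (x + 1) - damp p x).
Proof.
  intros Hp x.
  assert (HI : forall a b, ex_RInt (damp p) a b).
  { intros a b. apply (ex_RInt_continuous (V := R_CompleteNormedModule)).
    intros; now apply continuous_damp. }
  assert (HG : forall y, is_derive (fun y => RInt (damp p) 0 y) y (damp p y)).
  { intros y. apply (is_derive_RInt (damp p) _ 0).
    - apply filter_forall. intros b. apply (RInt_correct (damp p)), HI.
    - now apply continuous_damp. }
  apply (is_derive_ext (fun x => RInt (damp p) 0 (x + 1) - RInt (damp p) 0 x)).
  - intros t. unfold window.
    rewrite <- (RInt_Chasles (damp p) 0 t (t + 1)) by apply HI.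
    unfold plus; simpl. ring.
  - apply (is_derive_minus (fun x => RInt (damp p) 0 (x + 1))).
    + replace (damp p (x + 1)) with (scal 1 (damp p (x + 1)))
        by apply (scal_one (damp p (x + 1))).
      apply (is_derive_comp (fun y => RInt (damp p) 0 y) (fun x => x + 1)).
      * apply HG.
      * auto_derive; [auto | ring].
    + apply HG.
Qed.

Lemma window_bounds (p : R -> R) :
  (forall x, continuous p x) -> (forall x y, x <= y -> p x <= p y) ->
  forall x, damp p (x + 1) <= window p x <= damp p x.
Proof.
  intros Hc Hp x.
  assert (Hmono : forall a b, a <= b -> damp p b <= damp p a).
  { intros a b Hab. apply exp_le. specialize (Hp a b Hab). lra. }
  assert (HI : ex_RInt (damp p) x (x + 1)).
  { apply (ex_RInt_continuous (V := R_CompleteNormedModule)).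
    intros; now apply continuous_damp. }
  assert (Hconst : forall c : R, RInt (fun _ => c) x (x + 1) = c).
  { intros c. rewrite RInt_const. unfold scal; simpl; unfold mult; simpl. ring. }
  unfold window. split.
  - rewrite <- (Hconst (damp p (x + 1))).
    apply RInt_le; [lra | apply ex_RInt_const | exact HI |].
    intros; apply Hmono; lra.
  - rewrite <- (Hconst (damp p x)).
    apply RInt_le; [lra | exact HI | apply ex_RInt_const |].
    intros; apply Hmono; lra.
Qed.

(** * The logarithmic derivative *)

(** Rapid variation follows from exponential growth measured against a unit
    delay, since [lambda x] outruns [x + 1] linearly for [lambda > 1]. *)
Lemma rapidly_varying_of_exp_growth (h : R -> R) :
  (forall x, continuous h x) -> (forall x, 0 < h x) ->
  (forall x y, x + 1 <= y -> h x * exp (y - x - 1) <= h y) ->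
  rapidly_varying h.
Proof.
  intros Hc Hpos Hgrow. split; [|split].
  - exists 0. split; [now apply continuous_on_of_continuous | auto].
  - intros l Hl.
    apply (is_lim_le_le_loc (fun _ => 0) (fun x => exp ((l - 1) * x + 1))).
    + exists (1 / (1 - l)). intros x Hx.
      assert (Hx' : l * x + 1 <= x).
      { apply Rlt_le in Hx. apply Rle_div_l in Hx; [|lra]. lra. }
      split; [apply Rlt_le, Rdiv_lt_0_compat; apply Hpos|].
      apply Rle_div_l; [apply Hpos|].
      apply (Rmult_le_reg_r (exp (x - l * x - 1))); [apply exp_pos|].
      eapply Rle_trans; [apply Hgrow, Hx'|].
      replace (exp ((l - 1) * x + 1) * h x * exp (x - l * x - 1))
        with (h x * (exp ((l - 1) * x + 1) * exp (x - l * x - 1))) by ring.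
      rewrite <- exp_plus.
      replace ((l - 1) * x + 1 + (x - l * x - 1)) with 0 by ring.
      rewrite exp_0. lra.
    + apply is_lim_const.
    + apply is_lim_exp_affine_m. lra.
  - intros l Hl.
    apply (is_lim_le_p_loc (fun x => exp ((l - 1) * x + - 1))).
    + exists (1 / (l - 1)). intros x Hx.
      assert (Hx' : x + 1 <= l * x).
      { apply Rlt_le in Hx. apply Rle_div_l in Hx; [|lra]. lra. }
      apply Rle_div_r; [apply Hpos|].
      rewrite Rmult_comm.
      replace ((l - 1) * x + -1) with (l * x - x - 1) by ring.
      apply Hgrow, Hx'.
    + apply is_lim_exp_affine_p. lra.
Qed.

Definition rate (p : R -> R) (x : R) : R := / window p x.

Definition rate' (p : R -> R) (x : R) : R :=
  (damp p x - damp p (x + 1)) * rate p x ^ 2.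

Section Rate.

Context (p : R -> R)
  (p_continuous : forall x, continuous p x)
  (p_nondecreasing : forall x y, x <= y -> p x <= p y).

Lemma window_pos (x : R) : 0 < window p x.
Proof.
  apply (Rlt_le_trans _ (damp p (x + 1))); [apply damp_pos|].
  now apply window_bounds.
Qed.

Lemma rate_pos (x : R) : 0 < rate p x.
Proof. apply Rinv_0_lt_compat, window_pos. Qed.

Lemma is_derive_rate (x : R) : is_derive (rate p) x (rate' p x).
Proof.
  assert (Hw := window_pos x).
  unfold rate', rate.
  replace ((damp p x - damp p (x + 1)) * (/ window p x) ^ 2)
    with (- (damp p (x + 1) - damp p x) / window p x ^ 2) by (field; lra).
  apply is_derive_inv; [now apply is_derive_window | lra].
Qed.

Lemma continuous_rate (x : R) : continuous (rate p) x.
Proof. now apply (continuous_of_is_derive _ _ _ (is_derive_rate _)). Qed.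

Lemma continuous_rate' (x : R) : continuous (rate' p) x.
Proof.
  unfold rate'.
  apply (continuous_mult (fun x => damp p x - damp p (x + 1))).
  - apply (continuous_minus (damp p)); [now apply continuous_damp|].
    apply (continuous_comp (fun x => x + 1)); [|now apply continuous_damp].
    apply (ex_derive_continuous (V := R_NormedModule)). auto_derive; auto.
  - apply (continuous_comp (rate p) (fun y => y ^ 2)); [apply continuous_rate|].
    apply (ex_derive_continuous (V := R_NormedModule)). auto_derive; auto.
Qed.

Lemma rate'_nonneg (x : R) : 0 <= rate' p x.
Proof.
  apply Rmult_le_pos; [|apply pow2_ge_0].
  assert (H := window_bounds p p_continuous p_nondecreasing x). lra.
Qed.

Lemma rate_ge (x : R) : 0 <= x -> p x <= rate p x.
Proof.
  intros Hx.
  apply (Rle_trans _ (exp (x + p x))).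
  - assert (H := exp_ineq1_le (x + p x)). lra.
  - rewrite <- (Rinv_inv (exp (x + p x))), <- exp_Ropp.
    apply Rinv_le_contravar; [apply window_pos | now apply window_bounds].
Qed.

(** The window at [x] lies to the left of [x + 1 <= y] and the one at [y] to the
    right of [y], so the exponential decay of [damp p] between [x + 1] and [y]
    separates the two averages. *)
Lemma rate_growth (x y : R) : x + 1 <= y -> rate p x * exp (y - x - 1) <= rate p y.
Proof.
  intros Hxy. unfold rate.
  rewrite <- (Rinv_inv (exp (y - x - 1))), <- exp_Ropp, <- Rinv_mult.
  apply Rinv_le_contravar; [apply window_pos|].
  apply (Rle_trans _ (damp p y)); [now apply window_bounds|].
  eapply Rle_trans; [exact (damp_decreasing p p_nondecreasing _ _ Hxy)|].
  rewrite Rmult_comm.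
  replace (- (y - (x + 1))) with (- (y - x - 1)) by ring.
  apply Rmult_le_compat_r; [apply Rlt_le, exp_pos | now apply window_bounds].
Qed.

(** The quotient is the decrement of [damp p] over the unit window: it
    tends to [0] although [rate' p] itself may grow arbitrarily fast. *)
Lemma is_lim_rate'_over_square :
  is_lim (fun x => rate' p x / rate p x ^ 2) p_infty 0.
Proof.
  apply (is_lim_ext (fun x => damp p x - damp p (x + 1))).
  - intros x. unfold rate'. assert (H := rate_pos x). field. lra.
  - apply (is_lim_le_le_loc (fun _ => 0) (damp p)).
    + exists 0. intros x _.
      assert (H := window_bounds p p_continuous p_nondecreasing x).
      assert (H' := damp_pos p (x + 1)). lra.
    + apply is_lim_const.
    + now apply is_lim_damp.
Qed.

End Rate.

(** * Exponential primitives *)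

Definition exp_primitive (h : R -> R) (x : R) : R := exp (RInt h 0 x).

Lemma is_derive_primitive (h : R -> R) :
  (forall x, continuous h x) -> forall x, is_derive (RInt h 0) x (h x).
Proof.
  intros Hh x. apply (is_derive_RInt h _ 0); [|apply Hh].
  apply filter_forall. intros b. apply (RInt_correct h).
  apply (ex_RInt_continuous (V := R_CompleteNormedModule)). auto.
Qed.

Lemma is_derive_exp_primitive (h : R -> R) :
  (forall x, continuous h x) ->
  forall x, is_derive (exp_primitive h) x (h x * exp_primitive h x).
Proof.
  intros Hh x. apply (is_derive_comp exp (RInt h 0)).
  - apply is_derive_exp.
  - now apply is_derive_primitive.
Qed.

Lemma is_derive2_exp_primitive (h dh : R -> R) :
  (forall x, is_derive h x (dh x)) ->
  forall x, is_derive (fun x => h x * exp_primitive h x) x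
              ((dh x + h x ^ 2) * exp_primitive h x).
Proof.
  intros Hh x.
  assert (Hc : forall x, continuous h x).
  { intros y. now apply (continuous_of_is_derive _ _ _ (Hh _)). }
  replace ((dh x + h x ^ 2) * exp_primitive h x)
    with (plus (mult (dh x) (exp_primitive h x))
               (mult (h x) (h x * exp_primitive h x)))
    by (unfold plus, mult; simpl; ring).
  apply (is_derive_mult h); [apply Hh | now apply is_derive_exp_primitive |].
  intros n m; apply Rmult_comm.
Qed.

(** * The comparison function *)

Theorem lemma7p2 (r : R -> R)
  (r_nonneg : forall x, 0 <= x -> 0 <= r x)
  (r_C2 : is_Cn_on 2 nonneg_half_line r)
  (r''_pos : forall x, 0 < x -> 0 < Derive_n r 2 x)
  (r_0 : r 0 = 0)
  (r'_0 : is_derive_within nonneg_half_line r 0 1)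
  (r'_infty : is_lim (Derive r) p_infty p_infty) :
  exists J : R -> R,
    (forall x, 0 <= x -> 0 <= J x) /\
    0 < J 0 /\
    is_Cn_on 1 nonneg_half_line J /\
    increasing_on nonneg_half_line J /\
    convex_on nonneg_half_line J /\
    (exists a : R, 0 <= a /\ is_Cn_on 2 (fun x => a < x) J) /\
    (exists rho : Rbar, Rbar_lt 0 rho /\
       varying_of_index (Derive (fun x => ln (J x))) (Rbar_minus rho 1)) /\
    is_lim (fun u => (Derive J u) ^ 2 / (Derive_n J 2 u * J u)) p_infty 1 /\
    (forall x, 0 <= x -> exp (r x) <= J x).
Proof.
  destruct r_C2 as [r' [Hr [r'' [Hr' _]]]].
  assert (Hder : forall x, 0 < x -> is_derive r x (r' x)).
  { intros x Hx. apply (is_derive_of_is_derive_within nonneg_half_line).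
    - now apply locally_nonneg_half_line.
    - apply Hr. unfold nonneg_half_line; lra. }
  assert (Hr''_nonneg : forall x, 0 < x -> 0 <= r'' x).
  { intros x Hx. apply Rlt_le. replace (r'' x) with (Derive_n r 2 x); [auto|].
    apply is_derive_unique. apply (is_derive_ext_loc r').
    - apply (filter_imp (fun y => 0 < y)); [|now apply (open_gt 0)].
      intros y Hy. symmetry. now apply is_derive_unique, Hder.
    - apply (is_derive_of_is_derive_within nonneg_half_line).
      + now apply locally_nonneg_half_line.
      + apply Hr'. unfold nonneg_half_line; lra. }
  assert (Hr'_incr : increasing_on nonneg_half_line r')
    by now apply (increasing_on_of_derive_nonneg _ r'').
  set (p := fun t => r' (Rmax t 0)).
  assert (Hpc : forall x, continuous p x)
    by (apply continuous_clamped, (continuous_on_of_derive_within _ _ r''), Hr').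
  assert (Hpm : forall x y, x <= y -> p x <= p y).
  { intros x y Hxy. apply Hr'_incr; try apply Rmax_r.
    now apply Rle_max_compat_r. }
  set (h := rate p). set (J := exp_primitive h).
  assert (Hh : forall x, is_derive h x (rate' p x)) by now apply is_derive_rate.
  assert (Hhc : forall x, continuous h x) by now apply continuous_rate.
  assert (Hhpos : forall x, 0 < h x) by now apply rate_pos.
  assert (HJpos : forall x, 0 < J x) by (intros x; apply exp_pos).
  assert (HJ1 : forall x, is_derive J x (h x * J x))
    by now apply is_derive_exp_primitive.
  assert (HJ2 : forall x, is_derive (fun x => h x * J x) x
                            ((rate' p x + h x ^ 2) * J x))
    by now apply is_derive2_exp_primitive.
  assert (HJ1c : forall x, continuous (fun x => h x * J x) x).
  { intros x. now apply (continuous_of_is_derive _ _ _ (HJ2 _)). }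
  assert (HJ2nonneg : forall x, 0 <= (rate' p x + h x ^ 2) * J x).
  { intros x. apply Rmult_le_pos; [|now apply Rlt_le].
    apply Rplus_le_le_0_compat; [now apply rate'_nonneg | apply pow2_ge_0]. }
  assert (HJ1incr : forall x y, x <= y -> h x * J x <= h y * J y).
  { intros x y Hxy.
    destruct (MVT_gen (fun x => h x * J x) x y _ (fun z _ => HJ2 z)) as [c [_ Hc]].
    - intros z _. apply continuity_pt_filterlim, HJ1c.
    - assert (0 <= ((rate' p c + h c ^ 2) * J c) * (y - x))
        by (apply Rmult_le_pos; [apply HJ2nonneg | lra]).
      simpl in *; lra. }
  exists J.
  split; [|split; [|split; [|split; [|split; [|split; [|split; [|split]]]]]]].
  - intros x _. apply Rlt_le, HJpos.
  - apply HJpos.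
  - now apply (is_C1_everywhere _ _ (fun x => h x * J x)).
  - apply (increasing_on_of_derive_nonneg _ (fun x => h x * J x)).
    + intros x Hx. now apply is_derive_within_of_is_derive.
    + intros x _. apply Rmult_le_pos; now apply Rlt_le.
  - now apply (convex_on_of_derive_nondecreasing _ _ (fun x => h x * J x)).
  - exists 0. split; [lra|].
    exists (fun x => h x * J x). split.
    + intros x Hx. now apply is_derive_within_of_is_derive.
    + apply (is_C1_everywhere _ _ (fun x => (rate' p x + h x ^ 2) * J x));
        [exact HJ2|].
      intros x. apply (continuous_mult (fun x => rate' p x + h x ^ 2)).
      * apply (continuous_plus (rate' p)); [now apply continuous_rate'|].
        apply (continuous_comp h (fun y => y ^ 2)); [apply Hhc|].
        apply (ex_derive_continuous (V := R_NormedModule)). auto_derive; auto.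
      * now apply (continuous_of_is_derive _ _ _ (HJ1 _)).
  - exists p_infty. split; [exact I|].
    replace (Derive (fun x => ln (J x))) with h.
    + apply rapidly_varying_of_exp_growth; [exact Hhc | exact Hhpos |].
      now apply rate_growth.
    + apply functional_extensionality. intros x. symmetry.
      apply is_derive_unique. apply (is_derive_ext (RInt h 0)).
      * intros t. symmetry. apply ln_exp.
      * now apply is_derive_primitive.
  - apply (is_lim_ext (fun u => / (1 + rate' p u / h u ^ 2))).
    + intros u.
      assert (HD1 : forall x, Derive J x = h x * J x)
        by (intros x; apply is_derive_unique, HJ1).
      replace (Derive_n J 2 u) with ((rate' p u + h u ^ 2) * J u).
      * rewrite HD1.
        assert (H1 := rate'_nonneg p Hpc Hpm u).
        specialize (Hhpos u). specialize (HJpos u).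
        field. repeat split; nra.
      * symmetry. change (Derive (Derive J) u = (rate' p u + h u ^ 2) * J u).
        rewrite (Derive_ext _ (fun x => h x * J x)) by exact HD1.
        apply is_derive_unique, HJ2.
    + replace (Finite 1) with (Rbar_inv (Rbar_plus 1 0))
        by (simpl; f_equal; lra).
      apply is_lim_inv.
      * apply is_lim_plus'; [apply is_lim_const|].
        now apply is_lim_rate'_over_square.
      * simpl. intros H. injection H. lra.
  - intros x Hx.
    assert (Hincr : increasing_on nonneg_half_line (fun x => RInt h 0 x - r x)).
    { apply (increasing_on_of_derive_nonneg _ (fun x => h x - r' x)).
      - intros y Hy. apply is_derive_within_minus; [|now apply Hr].
        apply is_derive_within_of_is_derive; [exact Hy|].
        now apply is_derive_primitive.
      - intros y Hy.
        assert (Hge : p y <= h y) by (apply rate_ge; auto; lra).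
        unfold p in Hge. rewrite Rmax_left in Hge; lra. }
    specialize (Hincr 0 x (Rle_refl 0) Hx Hx).
    simpl in Hincr. rewrite RInt_point, r_0 in Hincr.
    unfold zero in Hincr; simpl in Hincr.
    apply exp_le. lra.
Qed.
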